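(* Let $1\le r_0<\infty$ and let $A$ be a positive continuous non-decreasing function on $[r_0,\infty)$ such that $$\limsup_{t\to\infty}\frac{\log A(t)}{\log t}=\rho,\qquad \liminf_{t\to\infty}\frac{\log A(t)}{\log t}=\lambda,\qquad 0\le\lambda<\rho<\infty.$$ Then, for each fixed $\eta\in(0,\rho-\lambda)$, there exists a quasi proximate order $\sigma=\sigma_{\rho,\lambda,\eta}:[r_0,\infty)\to(0,\infty)$, with an associated function $A^*=A^*_\sigma:[r_0,\infty)\to(0,\infty)$, such that (1) $\limsup_{t\to\infty}\sigma(t)=\rho$; (2) $\liminf_{t\to\infty}\sigma(t)=\lambda+\eta$; (3) $A(t)\le t^{\sigma(t)}$ for all $r_0\le t<\infty$.
   Context: Let $1\le r_0<\infty$. A function $\sigma:[r_0,\infty)\to(0,\infty)$ is called a quasi proximate order if there exist two constants $0\le\lambda_\sigma<\rho_\sigma<\infty$ and an associated function $A^*=A^*_\sigma:[r_0,\infty)\to(0,\infty)$ such that (i) $\sigma\in C^1[r_0,\infty)$; (ii) $\limsup_{t\to\infty}\sigma(t)=\rho_\sigma$; (iii) $\liminf_{t\to\infty}\sigma(t)=\lambda_\sigma$; (iv) $\limsup_{t\to\infty}|\sigma'(t)|\,t\log t<\infty$; (v) $A^*$ is nondecreasing and $A^*(t)\le t^{\sigma(t)}\le(1+o(1))A^*(t)$ as $t\to\infty$.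
   Formalization: When r_0=1 it is additionally assumed that A(t) ≤ t^C on [1,2] for some constant C; without this (3) fails, e.g. at t=1 if A(1)=2, and the condition is necessary for (3) with σ of class C^1. *)

(* Defs.v *)
From HB Require Import structures.
From mathcomp Require Import all_boot all_order all_algebra.
From mathcomp Require Import all_classical all_reals all_analysis.

Set Implicit Arguments.
Unset Strict Implicit.
Unset Printing Implicit Defensive.

Import Order.TTheory GRing.Theory Num.Theory.
Import numFieldNormedType.Exports.

Local Open Scope classical_set_scope.
Local Open Scope ring_scope.

(* A function on [r0, +oo[ is represented by a total function R -> R; every
   condition below only involves its values on [r0, +oo[. *)

(* The difference quotient is restricted to D, so that the derivative is
   one-sided at an endpoint of D belonging to D. *)
Definition has_derivative_within (R : realType) (D : set R) (f : R -> R)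
    (x l : R) : Prop :=
  (f y - f x) / (y - x) @[y --> within D x^'] --> l.

Definition C1_on (R : realType) (D : set R) (f : R -> R) : Prop :=
  exists f' : R -> R,
    (forall x, D x -> has_derivative_within D f x (f' x)) /\
    {within D, continuous f'}.

(* Upper and lower limits of a real function at +oo, with values in \bar R. *)
Definition limsup_pinfty (R : realType) (f : R -> R) : \bar R :=
  limf_esup (fun t => (f t)%:E) (pinfty_nbhs R).

Definition liminf_pinfty (R : realType) (f : R -> R) : \bar R :=
  limf_einf (fun t => (f t)%:E) (pinfty_nbhs R).

Record quasi_proximate_order_with (R : realType) (r0 : R)
    (sigma Astar : R -> R) (lam rho : R) : Prop := QuasiProximateOrderWith {
  qpo_lam_ge0 : 0 <= lam ;
  qpo_lam_lt_rho : lam < rho ;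
  qpo_sigma_gt0 : forall t, r0 <= t -> 0 < sigma t ;
  qpo_Astar_gt0 : forall t, r0 <= t -> 0 < Astar t ;
  qpo_C1 : C1_on `[r0, +oo[ sigma ;
  qpo_limsup : limsup_pinfty sigma = rho%:E ;
  qpo_liminf : liminf_pinfty sigma = lam%:E ;
  (* For t > r0 the two-sided derivative depends only on sigma near t, and it
     is the derivative provided by qpo_C1. *)
  qpo_derivative :
    (limsup_pinfty (fun t => `|derive1 sigma t| * t * ln t)%R < +oo)%E ;
  qpo_Astar_nondecreasing :
    forall s t, r0 <= s -> s <= t -> Astar s <= Astar t ;
  qpo_Astar_le : forall t, r0 <= t -> Astar t <= t `^ sigma t ;
  (* e is the o(1) term. *)
  qpo_le_Astar : exists e : R -> R,
    e t @[t --> +oo] --> 0 /\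
    (\forall t \near +oo, t `^ sigma t <= (1 + e t) * Astar t)
}.

Definition quasi_proximate_order (R : realType) (r0 : R)
    (sigma Astar : R -> R) : Prop :=
  exists lam rho : R, quasi_proximate_order_with r0 sigma Astar lam rho.

(* Since 1 `^ s = 1 for every s, no A with 1 < A 1 satisfies A t <= t `^ sigma t
   at t = 1; more generally, a sigma that is continuous at 1 is bounded near 1,
   so this condition is necessary for A t <= t `^ sigma t on [1, +oo[. It is
   relevant only when the half-line starts at r0 = 1. *)
Definition power_bounded_near_one (R : realType) (A : R -> R) : Prop :=
  exists C : R, forall t, 1 <= t <= 2 -> A t <= t `^ C.

(* Main.v *)
Require Import Defs.
From HB Require Import structures.
From mathcomp Require Import all_boot all_order all_algebra.
From mathcomp Require Import all_classical all_reals all_analysis.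
From mathcomp Require Import ring lra.

Import Order.TTheory GRing.Theory Num.Theory.
Import numFieldNormedType.Exports.

Local Open Scope classical_set_scope.
Local Open Scope ring_scope.

Set Implicit Arguments.
Unset Strict Implicit.
Unset Printing Implicit Defensive.

(** In the coordinate x = ln t, put a(x) = ln A(e^x) and sigma(t) = s(ln t).  Then
    A(t) <= t^sigma(t) reads a(x) <= x s(x), and t ln t sigma'(t) = x s'(x).
    Writing W(x) = x s(x), it is enough to find W >= a which is nondecreasing,
    has a bounded derivative, makes W(x) / x of class C^1, and for which
    W(x) / x has upper limit rho and lower limit mu = lam + eta.  Indeed
    x s'(x) = W'(x) - W(x) / x is then bounded near +oo, and as W is
    nondecreasing, t^sigma(t) = e^W is its own associated function.  The
    obstacle is that a, though nondecreasing, may climb arbitrarily steeply.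

    Limiting the slope.  The sup-convolution
      S(x) = sup_y (a(y) - K max(0, y - x))
    is the least nondecreasing majorant of a with increments at most K times
    the step.  It anticipates each climb of a, but for K > rho it stays below
    (rho + o(1)) x, so the upper limit of the quotient by x is not raised.  The
    lower limit may be raised, but by as little as desired when K is large:
    if a(z) is about lam z, then S(c z) is still at most mu c z, for a fixed
    c < 1 with mu c > lam, as soon as K (1 - c) pays for any later climb.
    Hence T(x) = max (S(x), mu x) satisfies T(x) = mu x for arbitrarily large
    x, and T(x) / x has lower limit exactly mu ([lipschitz_regularization]).

    Smoothing.  The average U of T over [x, x + 1] is C^1, nondecreasing, and
    satisfies T <= U <= T + K ([moving_average]); a bounded error does not
    affect limits of quotients by x.  The remaining difficulty is at x = 0,
    which matters if r0 = 1: U(0) need not vanish, so U(x) / x may be singular.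
    One takes
      W(x) = U(x) x^2 / (1 + x^2) + 2 C x / (1 + x),
    where a(x) <= C x everywhere ([linear_bound]; near x = 0 this is the
    assumption on A near 1).  The first factor removes the singularity and the
    bounded second term makes up for the loss in the first, so that
    T <= W <= T + O(1) ([smoothing]). *)

(** * Upper and lower limits at infinity *)

(** Finite upper limits are used in this form throughout: an eventual bound from
    above is what a construction inherits from the hypotheses, a bound from
    below at arbitrarily large points is what pins the limit to its value. *)
Lemma limsup_pinftyP (R : realType) (f : R -> R) (l : R) :
  limsup_pinfty f = l%:E <->
  forall e, 0 < e -> (\forall t \near +oo, f t <= l + e) /\
                     (forall M, exists2 t, M < t & l - e <= f t).
Proof.
rewrite /limsup_pinfty limf_esupE; set I := ereal_inf _.
have I_le P : pinfty_nbhs R P ->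
    (I <= ereal_sup ((fun t => (f t)%:E) @` P))%E.
  by move=> PF; apply: ereal_inf_lbound; exists P.
split=> [Il e e0 | H].
  split.
    have : (I < (l + e)%:E)%E by rewrite Il lte_fin ltrDl.
    move=> /ereal_inf_lt [_ [P PF <-]] sPlt.
    apply: filterS PF => t Pt.
    rewrite -lee_fin; apply: le_trans (ltW sPlt).
    by apply: ereal_sup_ubound; exists t.
  move=> M; have /I_le : pinfty_nbhs R [set t : R | (M < t)%R].
    by exists M; split=> //; exact: num_real.
  rewrite Il => lsup.
  have : ((l - e)%:E < ereal_sup ((fun t => (f t)%:E) @` [set t : R | (M < t)%R]))%E.
    by apply: lt_le_trans lsup; rewrite lte_fin ltrBlDr ltrDl.
  by move=> /ereal_sup_gt [_ [t /= Mt <-]]; rewrite lte_fin => /ltW; exists t.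
apply/eqP; rewrite eq_le; apply/andP; split; apply/lee_addgt0Pr => e e0.
  have [He _] := H _ e0; apply: le_trans (I_le _ He) _.
  by apply: ge_ereal_sup => _ [t /= ft <-]; rewrite -EFinD lee_fin.
have [_ Hf] := H _ e0; rewrite -leeBlDr//.
apply: le_ereal_inf_tmp => _ [P [M [_ MP]] <-].
have [t Mt ft] := Hf M.
rewrite -EFinB; apply: (@le_trans _ _ (f t)%:E); first by rewrite lee_fin.
by apply: ereal_sup_ubound; exists t => //; exact: MP.
Qed.

Lemma liminf_pinftyN (R : realType) (f : R -> R) (l : R) :
  liminf_pinfty f = l%:E <-> limsup_pinfty (fun t => - f t) = (- l)%:E.
Proof.
have -> : liminf_pinfty f = (- limsup_pinfty (fun t => - f t)%R)%E.
  by rewrite /liminf_pinfty /limf_einf.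
by rewrite EFinN; split=> [<-|->]; rewrite oppeK.
Qed.

Lemma liminf_pinftyP (R : realType) (f : R -> R) (l : R) :
  liminf_pinfty f = l%:E <->
  forall e, 0 < e -> (\forall t \near +oo, l - e <= f t) /\
                     (forall M, exists2 t, M < t & f t <= l + e).
Proof.
rewrite liminf_pinftyN limsup_pinftyP; split=> H e e0; have [Hev Hfr] := H e e0; split.
- by apply: filterS Hev => t; lra.
- by move=> M; have [t Mt ft] := Hfr M; exists t => //; move: ft; lra.
- by apply: filterS Hev => t; lra.
- by move=> M; have [t Mt ft] := Hfr M; exists t => //; move: ft; lra.
Qed.

Lemma limsup_pinfty_le (R : realType) (f : R -> R) (B : R) :
  (\forall t \near +oo, f t <= B) -> (limsup_pinfty f <= B%:E)%E.
Proof.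
move=> fB; rewrite /limsup_pinfty limf_esupE.
apply: (@le_trans _ _ (ereal_sup ((fun t => (f t)%:E) @` [set t | f t <= B]))).
  by apply: ereal_inf_lbound; exists [set t | f t <= B].
by apply: ge_ereal_sup => _ [t /= ft <-]; rewrite lee_fin.
Qed.

Lemma near_pinfty_expR (R : realType) (P : R -> Prop) :
  (\forall t \near +oo, P t) -> \forall x \near +oo, P (expR x).
Proof.
move=> [N [_ NP]]; exists N; split; first exact: num_real.
move=> x Nx; apply: NP; apply: lt_trans Nx _.
by apply: lt_le_trans (expR_ge1Dx x); rewrite ltrDr.
Qed.

Lemma near_pinfty_ln (R : realType) (P : R -> Prop) :
  (\forall x \near +oo, P x) -> \forall t \near +oo, P (ln t).
Proof.
move=> [N [_ NP]]; exists (expR N); split; first exact: num_real.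
move=> t Nt; apply: NP; rewrite -[N]expRK ltr_ln// posrE ?expR_gt0//.
exact: lt_trans (expR_gt0 N) Nt.
Qed.

Lemma limsup_pinfty_expR (R : realType) (f : R -> R) (l : R) :
  limsup_pinfty f = l%:E -> limsup_pinfty (f \o expR) = l%:E.
Proof.
move=> /limsup_pinftyP fl; apply/limsup_pinftyP => e e0.
have [f_ev f_fr] := fl e e0; split; first exact: (near_pinfty_expR f_ev).
move=> M; have [t Mt ft] := f_fr (expR M).
have t0 : 0 < t := lt_trans (expR_gt0 M) Mt.
by exists (ln t); [rewrite -[M]expRK ltr_ln// posrE ?expR_gt0|rewrite /= lnK].
Qed.

Lemma limsup_pinfty_ln (R : realType) (f : R -> R) (l : R) :
  limsup_pinfty f = l%:E -> limsup_pinfty (fun t => f (ln t)) = l%:E.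
Proof.
move=> /limsup_pinftyP fl; apply/limsup_pinftyP => e e0.
have [f_ev f_fr] := fl e e0; split; first exact: (near_pinfty_ln f_ev).
move=> M; have [x Mx fx] := f_fr M.
exists (expR x); last by rewrite expRK.
apply: lt_trans Mx _.
by apply: lt_le_trans (expR_ge1Dx x); rewrite ltrDr.
Qed.

Lemma liminf_pinfty_expR (R : realType) (f : R -> R) (l : R) :
  liminf_pinfty f = l%:E -> liminf_pinfty (f \o expR) = l%:E.
Proof. by rewrite !liminf_pinftyN => /limsup_pinfty_expR. Qed.

Lemma liminf_pinfty_ln (R : realType) (f : R -> R) (l : R) :
  liminf_pinfty f = l%:E -> liminf_pinfty (fun t => f (ln t)) = l%:E.
Proof. by rewrite !liminf_pinftyN => /limsup_pinfty_ln. Qed.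

(** * Derivatives and primitives *)

(** The base point -1 of the integral only has to lie to the left of the half-line
    x >= 0, so that the derivative at 0 is two-sided. *)
Lemma continuous_primitive (R : realType) (T : R -> R) :
  continuous T -> exists P : R -> R, forall x : R, - 1 < x -> is_derive x 1 P (T x).
Proof.
move=> cT; exists (fun x => \int[lebesgue_measure]_(u in `[- 1, x]) T u)%R => x x1.
have := @continuous_FTC1_closed R T (- 1) x (x + 1) _ _ x1 (cT x).
case=> [||d1 d2]; first by rewrite ltrDl.
  apply: continuous_compact_integrable; first exact: segment_compact.
  exact: continuous_subspaceT.
by split; [exact: d1|rewrite -derive1E; exact: d2].
Qed.

(** The composed difference quotient at h = y - x is the one that defines the
    two-sided derivative, and restricting the filter keeps the limit. *)
Lemma is_derive_has_derivative_within (R : realType) (D : set R) (f : R -> R)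
    (x l : R) : is_derive x 1 f l -> has_derivative_within D f x l.
Proof.
move=> [df fl]; rewrite /has_derivative_within.
have : (fun h => h^-1 *: (f (h + x) - f x)) @ 0^' --> l.
  rewrite -fl; move: df; rewrite /derivable /derive.
  suff -> : (fun h => h^-1 *: (f (h + x) - f x)) =
            (fun h => h^-1 *: ((f \o shift x) (h *: 1) - f x)) by [].
  by apply/funext => h; rewrite /= [_ *: 1]mulr1.
move=> /cvgrPdist_lt Hl; apply/cvgrPdist_lt => e e0.
have [d /= d0 H] := Hl e e0.
apply: cvg_within; exists d => // y /= xy yx.
have := H (y - x); rewrite subrK subr_eq0 mulrC => -> //.
by rewrite /ball_ /= sub0r opprB.
Qed.

(** * Limiting the slope *)

(** The sup-convolution of a with the one-sided cone of slope K.  A point y to the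
    left of x contributes a(y) without penalty, which makes the result
    nondecreasing in x whatever a is. *)
Definition lipschitz_majorant (R : realType) (a : R -> R) (x0 K x : R) : R :=
  sup [set a y - K * Num.max 0 (y - x) | y in [set y | x0 <= y]].

Lemma has_sup_lipschitz_majorant (R : realType) (a : R -> R) (x0 K x : R) :
  0 <= K -> (forall y, x0 <= y -> a y <= K * y) ->
  has_sup [set a y - K * Num.max 0 (y - x) | y in [set y | x0 <= y]].
Proof.
move=> K0 aK; split; first by exists (a x0 - K * Num.max 0 (x0 - x)), x0 => /=.
exists (K * x) => _ [y /= xy <-].
have := aK _ xy; case: (leP 0 (y - x)) => yx; nra.
Qed.

Lemma lipschitz_majorant_le (R : realType) (a : R -> R) (x0 K x M : R) :
  (forall y, x0 <= y -> a y - K * Num.max 0 (y - x) <= M) ->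
  lipschitz_majorant a x0 K x <= M.
Proof.
move=> aM; apply: ge_sup.
  by exists (a x0 - K * Num.max 0 (x0 - x)), x0 => /=.
by move=> _ [y /= xy <-]; exact: aM.
Qed.

Lemma le_lipschitz_majorant (R : realType) (a : R -> R) (x0 K x y : R) :
  0 <= K -> (forall y, x0 <= y -> a y <= K * y) -> x0 <= y ->
  a y - K * Num.max 0 (y - x) <= lipschitz_majorant a x0 K x.
Proof.
move=> K0 aK xy; apply: sup_upper_bound; first exact: has_sup_lipschitz_majorant.
by exists y.
Qed.

Lemma lipschitz_majorant_nondecreasing (R : realType) (a : R -> R) (x0 K : R) :
  0 <= K -> (forall y, x0 <= y -> a y <= K * y) ->
  {homo lipschitz_majorant a x0 K : x y / x <= y}.
Proof.
move=> K0 aK x x' xx'; apply: lipschitz_majorant_le => y xy.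
apply: le_trans (le_lipschitz_majorant x' K0 aK xy).
rewrite lerD2l lerN2 ler_wpM2l// ge_max le_max lexx/= le_max.
by apply/orP; right; lra.
Qed.

(** Moving x to the right lowers each penalty by at most K times the step. *)
Lemma lipschitz_majorant_increment (R : realType) (a : R -> R) (x0 K x x' : R) :
  0 <= K -> (forall y, x0 <= y -> a y <= K * y) -> x <= x' ->
  lipschitz_majorant a x0 K x' <= lipschitz_majorant a x0 K x + K * (x' - x).
Proof.
move=> K0 aK xx'; apply: lipschitz_majorant_le => y xy.
have := le_lipschitz_majorant x K0 aK xy.
case: (leP 0 (y - x)) => yx; case: (leP 0 (y - x')) => yx'; nra.
Qed.

(** T is the maximum of the slope-limited majorant of a and of mu x.  The slope K
    is chosen so large that at each z where a(z) is about lam z, the majorant at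
    c z, a fixed proportion before z, has not yet started to anticipate the
    growth of a after z; there T(x) = mu x. *)
Lemma lipschitz_regularization (R : realType) (a : R -> R)
    (x0 C rho lam mu : R) :
  0 <= x0 -> 0 <= lam -> lam < mu -> mu < rho -> rho <= C ->
  (forall x y, x0 <= x -> x <= y -> a x <= a y) ->
  (forall x, x0 <= x -> a x <= C * x) ->
  (forall e, 0 < e -> \forall x \near +oo, a x <= (rho + e) * x) ->
  (forall e, 0 < e -> forall M, exists2 x, M < x & a x <= (lam + e) * x) ->
  exists (T : R -> R) (K : R),
    [/\ {homo T : x y / x <= y},
        forall x y, x <= y -> T y <= T x + K * (y - x),
        forall x, x0 <= x -> a x <= T x &
        forall x, 0 <= x -> mu * x <= T x <= C * x] /\
    (forall e, 0 < e -> \forall x \near +oo, T x <= (rho + e) * x) /\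
    (forall M, exists2 x, M < x & T x <= mu * x).
Proof.
move=> x00 lam0 lam_mu mu_rho rhoC a_nd aC a_ev a_fr.
(* mu c is the midpoint of lam and mu, which leaves room on both sides; K makes
   C z - K (z - c z) vanish. *)
pose c := (lam + mu) / (2 * mu); pose K := C / (1 - c).
have mu0 : 0 < mu by lra.
have muc : mu * c = (lam + mu) / 2 by rewrite /c; field; lra.
have c0 : 0 < c by rewrite /c divr_gt0//; lra.
have c1 : c < 1 by nra.
have KC : K * (1 - c) = C by rewrite /K divfK//; lra.
have CK : C <= K by nra.
have K0 : 0 <= K by lra.
have aK y : x0 <= y -> a y <= K * y.
  by move=> xy; apply: le_trans (aC _ xy) _; rewrite ler_wpM2r//; lra.
pose S := lipschitz_majorant a x0 K.
have S_nd := lipschitz_majorant_nondecreasing K0 aK.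
(* Asymptotic linear bounds of slope at most K pass from a to S: the points
   before x are handled by monotonicity, those after x by the penalty. *)
have S_le L X x : x0 <= X -> X <= x -> 0 <= L -> L <= K ->
    (forall y, X <= y -> a y <= L * y) -> S x <= L * x.
  move=> xX Xx L0 LK aL; apply: lipschitz_majorant_le => y xy.
  case: (leP 0 (y - x)) => yx.
    have Xy : X <= y by lra.
    by have := aL y Xy; nra.
  have yx' : y <= x by lra.
  have := aL x Xx; have := a_nd y x xy yx'; lra.
have S_leC x : 0 <= x -> S x <= C * x.
  move=> x0'; apply: lipschitz_majorant_le => y xy; have := aC _ xy.
  case: (leP 0 (y - x)) => yx; nra.
have max_le L x : 0 <= x -> mu <= L -> S x <= L * x ->
    Num.max (S x) (mu * x) <= L * x.
  by move=> x0' muL SL; rewrite ge_max SL ler_wpM2r.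
exists (fun x => Num.max (S x) (mu * x)), K; split; first split.
- move=> x y xy; rewrite ge_max !le_max S_nd//=.
  by rewrite (_ : mu * x <= mu * y) ?orbT// ler_wpM2l// ltW.
- move=> x y xy; rewrite ge_max; apply/andP; split.
    apply: le_trans (lipschitz_majorant_increment K0 aK xy) _.
    by rewrite lerD2r le_max lexx.
  apply: (@le_trans _ _ (mu * x + K * (y - x))).
    have -> : mu * y = mu * x + mu * (y - x) by ring.
    by rewrite lerD2l ler_wpM2r//; lra.
  by rewrite lerD2r le_max lexx orbT.
- move=> x xx; rewrite le_max; apply/orP; left.
  have := le_lipschitz_majorant x K0 aK xx.
  by rewrite subrr maxxx mulr0 subr0.
- move=> x x0'; rewrite le_max lexx orbT/= max_le ?S_leC//; lra.
- split=> [e e0|M].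
    have [X [_ aX]] := a_ev e e0.
    (* For e with rho + e > K the penalty is too weak, but then the global bound
       by C x is stronger than the one sought. *)
    exists (Num.max x0 (X + 1)); split; first exact: num_real.
    move=> x; rewrite gt_max => /andP[xx Xx].
    have x_ge0 : 0 <= x by lra.
    apply: max_le => //; first lra.
    have [Ke|/ltW eK] := leP K (rho + e).
      by apply: le_trans (S_leC _ x_ge0) _; rewrite ler_wpM2r//; lra.
    apply: (S_le _ (Num.max x0 (X + 1))) => //.
    - by rewrite le_max lexx.
    - by rewrite ge_max !ltW.
    - by lra.
    - by move=> y; rewrite ge_max => /andP[_ Xy]; apply: aX; lra.
  have [x + ax] := a_fr ((mu - lam) / 2) ltac:(lra) (Num.max x0 (M / c)).
  rewrite gt_max ltr_pdivrMr// => /andP[xx Mx].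
  have {}ax : a x <= mu * (c * x) 
    by rewrite mulrA muc (_ : (lam + mu) / 2 = lam + (mu - lam) / 2)//; field.
  exists (c * x); first by rewrite mulrC.
  rewrite ge_max lexx andbT; apply: lipschitz_majorant_le => y xy.
  have [yx|/ltW xy'] := leP y x.
    apply: le_trans (_ : a x <= _) => //; rewrite lerBlDr.
    apply: le_trans (a_nd _ _ xy yx) _.
    by rewrite lerDl mulr_ge0// le_max lexx.
  have := aC _ xy; rewrite max_r; last by nra.
  (* Beyond x the bound C y - K (y - c x) decreases in y, from the value 0 at y = x. *)
  have : K * (c * x) = (K - C) * x by rewrite -KC; ring.
  have x_ge0 : 0 <= x by lra.
  have := mulr_ge0 (ltW mu0) (mulr_ge0 (ltW c0) x_ge0).
  have : (K - C) * x <= (K - C) * y by rewrite ler_wpM2l//; lra.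
  lra.
Qed.

(** * Smoothing *)

Lemma continuous_bounded_increment (R : realType) (T : R -> R) (K : R) :
  {homo T : x y / x <= y} -> (forall x y, x <= y -> T y <= T x + K * (y - x)) ->
  continuous T.
Proof.
move=> T_nd T_lip x; apply/cvgrPdist_le => e e0.
have K0 : 0 <= K by have := T_lip 0 1 ler01; have := T_nd _ _ (@ler01 R); lra.
have d0 : 0 < e / (K + 1) by rewrite divr_gt0//; lra.
exists (e / (K + 1)) => // y /= /ltW; rewrite ler_pdivlMr ?ltr_wpDl// => xy.
have [le_xy|/ltW le_yx] := leP x y.
  have := T_lip _ _ le_xy; have := T_nd _ _ le_xy.
  move: xy; rewrite ler0_norm ?subr_le0// [in X in _ -> _ -> X <= _]distrC.
  by move=> xy Txy; rewrite ger0_norm ?subr_ge0//; nra.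
have := T_lip _ _ le_yx; have := T_nd _ _ le_yx.
move: xy; rewrite ger0_norm ?subr_ge0//.
by move=> xy Txy; rewrite ger0_norm ?subr_ge0//; nra.
Qed.

(** The average of T over [x, x + 1] is a difference of values of a primitive;
    as T is nondecreasing, it lies between T(x) and T(x + 1). *)
Lemma moving_average (R : realType) (T : R -> R) (K : R) :
  {homo T : x y / x <= y} -> (forall x y, x <= y -> T y <= T x + K * (y - x)) ->
  exists U : R -> R,
    [/\ forall x : R, 0 <= x -> is_derive x 1 U (T (x + 1) - T x),
        forall x, 0 <= x -> T x <= U x <= T x + K &
        forall x y, 0 <= x -> x <= y -> U x <= U y].
Proof.
move=> T_nd T_lip.
have [P dP] := continuous_primitive (continuous_bounded_increment T_nd T_lip).
have dU (x : R) : 0 <= x -> is_derive x 1 (fun x => P (x + 1) - P x) (T (x + 1) - T x).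
  move=> x0.
  have dPx : is_derive x 1 P (T x) by apply: dP; lra.
  have dPx1 : is_derive (shift 1 x) 1 P (T (x + 1)) by apply: dP => /=; lra.
  have dsh : is_derive x 1 (shift 1 : R -> R) 1 by exact: is_derive_shift.
  have dPs := is_derive1_comp dPx1 dsh.
  by apply: is_derive_eq; rewrite mulr1.
have segc (f df : R -> R) (a b : R) : 0 <= a -> (forall x : R, 0 <= x -> is_derive x 1 f (df x)) ->
    {within `[a, b], continuous f}.
  move=> a0 df_f; apply: continuous_in_subspaceT => z; rewrite inE/= in_itv/=.
  move=> /andP[az _]; have [fz _] := df_f z (le_trans a0 az).
  exact/differentiable_continuous/derivable1_diffP.
exists (fun x => P (x + 1) - P x); split => // [x x0|x y x0 xy].
  have dPz (z : R) : 0 <= z -> is_derive z 1 P (T z) by move=> z0; apply: dP; lra.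
  have [|||z] := @MVT_segment R P T x (x + 1).
  - by lra.
  - by move=> z; rewrite in_itv/= => /andP[xz _]; apply: dPz; lra.
  - exact: segc dPz.
  rewrite in_itv/= => /andP[xz zx] ->; rewrite addrAC subrr add0r mulr1.
  have := T_nd _ _ xz; have := T_nd _ _ zx; have := T_lip x (x + 1).
  by rewrite addrAC subrr add0r mulr1 lerDl => /(_ ler01); lra.
have [||z] := @MVT_segment R (fun x => P (x + 1) - P x) (fun x => T (x + 1) - T x) x y xy.
- by move=> z; rewrite in_itv/= => /andP[xz _]; apply: dU; lra.
- exact: segc dU.
rewrite in_itv/= => /andP[xz zy] E; rewrite -subr_ge0 E mulr_ge0 ?subr_ge0//.
by apply: T_nd; lra.
Qed.

Lemma is_derive_damped (R : realType) (U : R -> R) (c u x : R) : 0 <= x ->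
  is_derive x 1 U u ->
  is_derive x 1 (fun y => U y * (y / (1 + y ^+ 2)) + c / (1 + y))
    (u * (x / (1 + x ^+ 2)) + U x * ((1 - x ^+ 2) / (1 + x ^+ 2) ^+ 2)
     - c / (1 + x) ^+ 2).
Proof.
move=> x0 dU.
have sq0 : 1 + x ^+ 2 != 0 by rewrite lt0r_neq0// ltr_pwDl// sqr_ge0.
have x1 : 1 + x != 0 by rewrite lt0r_neq0// ltr_pwDl.
have d1 : is_derive x (1 : R) (fun y : R => 1 + y ^+ 2) (2 * x).
  have : is_derive x (1 : R) (cst 1 + (@id R) ^+ 2) (2 * x).
    by apply: is_derive_eq; rewrite add0r expr1 /GRing.scale/= mulr1.
  exact.
have d2 : is_derive x (1 : R) (fun y : R => y / (1 + y ^+ 2)) _ :=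
  is_deriveM (is_derive_id x (1 : R))
    (is_deriveV (f := fun y : R => 1 + y ^+ 2) sq0 d1).
have d3 : is_derive x (1 : R) (fun y : R => 1 + y) 1.
  have : is_derive x (1 : R) (cst 1 + @id R) 1.
    by apply: is_derive_eq; rewrite add0r.
  exact.
have d4 := is_deriveV (f := fun y : R => 1 + y) x1 d3.
have d5 : is_derive x 1 (fun y => U y * (y / (1 + y ^+ 2)) + c / (1 + y)) _ :=
  is_deriveD (is_deriveM dU d2) (is_deriveM (is_derive_cst c x 1) d4).
apply: is_derive_eq d5 _; rewrite /GRing.scale/=.
by field; rewrite x1 sq0.
Qed.

Lemma continuous_damped_derivative (R : realType) (U u : R -> R) (c x : R) :
  0 <= x -> {for x, continuous U} -> {for x, continuous u} ->
  {for x, continuous (fun y => u y * (y / (1 + y ^+ 2)) +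
     U y * ((1 - y ^+ 2) / (1 + y ^+ 2) ^+ 2) - c / (1 + y) ^+ 2)}.
Proof.
move=> x0 cU cu.
have cid : y @[y --> x] --> x by exact: cvg_id.
have csq : y ^+ 2 @[y --> x] --> x ^+ 2 by exact: exprn_continuous.
have cc (k : R) : k @[_ --> x] --> k by exact: cvg_cst.
have cq : 1 + y ^+ 2 @[y --> x] --> 1 + x ^+ 2 by exact: cvgD.
have cl : 1 + y @[y --> x] --> 1 + x by exact: cvgD.
have q0 : 1 + x ^+ 2 != 0 by rewrite lt0r_neq0// ltr_pwDl// sqr_ge0.
have l0 : 1 + x != 0 by rewrite lt0r_neq0// ltr_pwDl.
have cX (f : R -> R) : {for x, continuous f} -> {for x, continuous (fun y => f y ^+ 2)}.
  by move=> cf; exact: (cvgM cf cf).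
apply: cvgB; first apply: cvgD.
- by apply: cvgM => //; apply: cvgM => //; exact: cvgV.
- apply: cvgM => //; apply: cvgM; first exact: cvgB.
  by apply: cvgV; [rewrite expf_neq0|exact: cX cq].
- by apply: cvgM => //; apply: cvgV; [rewrite expf_neq0|exact: cX cl].
Qed.

(** Dividing the moving average by x would be singular at 0; the factor
    x^2 / (1 + x^2) cancels this and costs T(x) / (1 + x^2) <= C x / (1 + x^2),
    which the bounded nondecreasing term 2 C x / (1 + x) repays. *)
Lemma smoothing (R : realType) (T : R -> R) (K C : R) :
  0 < C -> {homo T : x y / x <= y} ->
  (forall x y : R, x <= y -> T y <= T x + K * (y - x)) ->
  (forall x : R, 0 <= x -> 0 <= T x <= C * x) ->
  exists s ds : R -> R,
    [/\ forall x : R, 0 <= x -> [/\ is_derive x 1 s (ds x),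
                                {for x, continuous ds} & 0 < s x],
        forall x y : R, 0 <= x -> x <= y -> x * s x <= y * s y,
        exists B, forall x : R, 0 <= x -> `|ds x| * x <= B &
        exists D, forall x : R, 0 <= x -> T x <= x * s x <= T x + D].
Proof.
move=> C0 T_nd T_lip T_bnd.
have [U [dU U_bnd U_nd]] := moving_average T_nd T_lip.
have cT := continuous_bounded_increment T_nd T_lip.
have cU (x : R) : 0 <= x -> {for x, continuous U}.
  by move=> /dU [+ _]; move/derivable1_diffP/differentiable_continuous.
pose s x := U x * (x / (1 + x ^+ 2)) + 2 * C / (1 + x).
pose ds x := (T (x + 1) - T x) * (x / (1 + x ^+ 2)) +
  U x * ((1 - x ^+ 2) / (1 + x ^+ 2) ^+ 2) - 2 * C / (1 + x) ^+ 2.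
have sq0 (x : R) : 0 < 1 + x ^+ 2 by rewrite ltr_pwDl// sqr_ge0.
have x1 (x : R) : 0 <= x -> 0 < 1 + x by lra.
have sE (x : R) : 0 <= x -> x * s x = U x * (x ^+ 2 / (1 + x ^+ 2)) + 2 * C * (x / (1 + x)).
  move=> x0; rewrite /s; field.
  by apply/andP; split; apply: lt0r_neq0; [exact: x1|exact: sq0].
have f_nd (x y : R) : 0 <= x -> x <= y -> x / (1 + x) <= y / (1 + y).
  move=> x0 xy; rewrite ler_pdivrMr ?x1// mulrAC ler_pdivlMr ?x1//; [nra|lra].
exists s, ds; split.
- move=> x x0; split.
  + exact: is_derive_damped (dU x x0).
  + have cu : {for x, continuous (fun y : R => T (y + 1) - T y)}.
      apply: cvgB; last exact: cT.
      apply: (@cvg_comp _ _ _ (fun y : R => y + 1) T); last exact: cT.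
      by apply: cvgD; [exact: cvg_id|exact: cvg_cst].
    exact: (continuous_damped_derivative x0 (cU x x0) cu).
  + rewrite /s ltr_wpDl//; last by rewrite divr_gt0// ?x1// mulr_gt0.
    have /andP[T0 _] := T_bnd x x0; have /andP[TU _] := U_bnd x x0.
    by apply: mulr_ge0; [exact: le_trans TU|rewrite divr_ge0// ltW].
- move=> x y x0 xy; rewrite !sE//; last by lra.
  apply: lerD; last by rewrite ler_wpM2l ?f_nd// mulr_ge0// ltW.
  have /andP[T0 _] := T_bnd x x0; have /andP[TU _] := U_bnd x x0.
  apply: ler_pM => //.
  + exact: le_trans TU.
  + by rewrite divr_ge0 ?sqr_ge0// ltW.
  + exact: U_nd.
  + by apply: f_nd; [exact: sqr_ge0|rewrite ler_sqr// nnegrE; lra].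
- exists (K + (C + K) + 2 * C) => x x0.
  have K0 : 0 <= K by have := T_lip 0 1 ler01; have := T_nd _ _ (@ler01 R); lra.
  have /andP[T0 TC] := T_bnd x x0; have /andP[TU UT] := U_bnd x x0.
  have dT0 : T x <= T (x + 1) by apply: T_nd; rewrite lerDl.
  have dTK : T (x + 1) <= T x + K.
    by have := T_lip x (x + 1); rewrite addrAC subrr add0r mulr1 lerDl => ->.
  pose p := x ^+ 2 / (1 + x ^+ 2); pose w := (1 - x ^+ 2) / (1 + x ^+ 2).
  pose v := U x * x / (1 + x ^+ 2); pose z := x / (1 + x) ^+ 2.
  rewrite -[X in _ * X](ger0_norm x0) -normrM.
  have -> : ds x * x = (T (x + 1) - T x) * p + v * w - 2 * C * z.
    rewrite /ds /p /w /v /z; field.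
    by apply/andP; split; apply: lt0r_neq0; [exact: x1|exact: sq0].
  have p0 : 0 <= p by rewrite divr_ge0 ?sqr_ge0// ltW.
  have p1 : p <= 1 by rewrite ler_pdivrMr//; lra.
  have z0 : 0 <= z by rewrite divr_ge0 ?sqr_ge0.
  have z1 : z <= 1 by rewrite ler_pdivrMr ?exprn_gt0 ?x1//; nra.
  have w1 : w <= 1 by rewrite ler_pdivrMr//; have := sqr_ge0 x; lra.
  have w0 : - 1 <= w by rewrite ler_pdivlMr//; have := sqr_ge0 x; lra.
  have v0 : 0 <= v by rewrite divr_ge0 ?(ltW (sq0 x))// mulr_ge0//; lra.
  have v1 : v <= C + K.
    rewrite ler_pdivrMr//.
    (* U x <= T x + K <= C x + K, and x <= 1 + x^2. *)
    have : U x * x <= (C * x + K) * x by rewrite ler_wpM2r//; lra.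
    have : 0 <= K * (x ^+ 2 - x + 1) by rewrite mulr_ge0//; nra.
    lra.
  have h1 : 0 <= (T (x + 1) - T x) * p by rewrite mulr_ge0// subr_ge0.
  have h2 : (T (x + 1) - T x) * p <= K by nra.
  have h3 : v * w <= C + K by nra.
  have h4 : - (C + K) <= v * w by nra.
  have h5 : 0 <= 2 * C * z by apply: mulr_ge0 => //; lra.
  have h6 : 2 * C * z <= 2 * C by rewrite ler_piMr//; lra.
  by rewrite ler_norml; apply/andP; split; lra.
exists (K + 2 * C) => x x0; rewrite sE//.
have /andP[T0 TC] := T_bnd x x0; have /andP[TU UT] := U_bnd x x0.
have U0 : 0 <= U x by lra.
(* T is the convex combination of T <= U and T <= C x with weights
   x^2 / (1 + x^2) and 1 / (1 + x^2). *)
have h1 : x ^+ 2 / (1 + x ^+ 2) = 1 - (1 + x ^+ 2)^-1.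
  by field; rewrite gt_eqF.
have h2 : x / (1 + x) <= 1 by rewrite ler_pdivrMr ?x1//; lra.
have h3 : 0 < (1 + x ^+ 2)^-1 by rewrite invr_gt0.
have h5 : (1 + x ^+ 2)^-1 <= 1 by rewrite invf_le1// lerDl sqr_ge0.
have h4 : x / (1 + x ^+ 2) <= 2 * (x / (1 + x)).
  rewrite mulrA ler_pdivrMr// mulrAC ler_pdivlMr ?x1//.
  have := sq0 x; nra.
rewrite h1; apply/andP; split; last first.
  have : U x * (1 - (1 + x ^+ 2)^-1) <= U x by rewrite ler_piMr//; lra.
  have := ler_wpM2l (ltW C0) h2; lra.
have : T x * (1 + x ^+ 2)^-1 <= C * (x / (1 + x ^+ 2)).
  by rewrite mulrA ler_wpM2r// ltW.
have : C * (x / (1 + x ^+ 2)) <= C * (2 * (x / (1 + x))) by rewrite ler_wpM2l// ltW.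
have : T x * (1 - (1 + x ^+ 2)^-1) <= U x * (1 - (1 + x ^+ 2)^-1).
  by rewrite ler_wpM2r//; lra.
lra.
Qed.

(** * The construction in logarithmic coordinates *)

(** The function x s(x) is squeezed between T and T + D, hence s(x) and T(x) / x
    have the same upper and lower limits; the lower bound rho of the upper limit
    comes from a itself. *)
Lemma log_regularization (R : realType) (a : R -> R) (x0 C rho lam mu : R) :
  0 <= x0 -> 0 <= lam -> lam < mu -> mu < rho -> rho <= C ->
  (forall x y, x0 <= x -> x <= y -> a x <= a y) ->
  (forall x, x0 <= x -> a x <= C * x) ->
  (forall e, 0 < e -> (\forall x \near +oo, a x / x <= rho + e) /\
                      (forall M, exists2 x, M < x & rho - e <= a x / x)) ->
  (forall e, 0 < e -> forall M, exists2 x, M < x & a x / x <= lam + e) ->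
  exists s ds : R -> R,
    [/\ forall x : R, 0 <= x -> [/\ is_derive x 1 s (ds x),
                                {for x, continuous ds} & 0 < s x],
        forall x y : R, 0 <= x -> x <= y -> x * s x <= y * s y,
        exists B, forall x : R, 0 <= x -> `|ds x| * x <= B &
        forall x, x0 <= x -> a x <= x * s x] /\
    limsup_pinfty s = rho%:E /\ liminf_pinfty s = mu%:E.
Proof.
move=> x00 lam0 lam_mu mu_rho rhoC a_nd aC a_sup a_inf.
have a_ev (e : R) : 0 < e -> \forall x \near +oo, a x <= (rho + e) * x.
  move=> e0; have [[X [_ aX]] _] := a_sup e e0.
  exists (Num.max 0 X); split; first exact: num_real.
  by move=> x; rewrite gt_max => /andP[x_gt0 Xx]; rewrite -ler_pdivrMr//; exact: aX.
have a_fr (e : R) : 0 < e -> forall M, exists2 x, M < x & a x <= (lam + e) * x.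
  move=> e0 M; have [x + ax] := a_inf e e0 (Num.max 0 M).
  rewrite gt_max => /andP[x_gt0 Mx]; exists x => //.
  by rewrite -ler_pdivrMr.
have [T [K [[T_nd T_lip aT T_bnd] [T_ev T_fr]]]] :=
  lipschitz_regularization x00 lam0 lam_mu mu_rho rhoC a_nd aC a_ev a_fr.
have [||s [ds [ds_s s_nd ds_B [D sT]]]] := smoothing _ T_nd T_lip (C := C).
- by lra.
- move=> x x0'; have /andP[muT ->] := T_bnd x x0'; rewrite andbT.
  by apply: le_trans muT; rewrite mulr_ge0//; lra.
have D0 : 0 <= D by have /andP[] := sT 0 (lexx _); lra.
exists s, ds; split.
  split=> // x xx; apply: le_trans (aT x xx) _.
  by have /andP[] := sT x (le_trans x00 xx).
(* Beyond D / e the additive error D costs at most e in the quotient by x. *)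
have De (e x : R) : 0 < e -> D / e < x -> D <= e * x.
  by move=> e0 /ltW; rewrite ler_pdivrMr// mulrC.
split.
- apply/limsup_pinftyP => e e0; have e2 : 0 < e / 2 by lra.
  split=> [|M].
    have [X [_ TX]] := T_ev _ e2.
    exists (Num.max 0 (Num.max X (D / (e / 2)))); split; first exact: num_real.
    move=> x; rewrite !gt_max => /and3P[x_gt0 Xx Dx].
    rewrite -(ler_pM2l x_gt0); have /andP[_] := sT x (ltW x_gt0).
    have := TX x Xx; have := De _ _ e2 Dx; lra.
  have [_ /(_ (Num.max x0 (Num.max 0 M)))[x + ax]] := a_sup e e0.
  rewrite !gt_max => /and3P[xx x_gt0 Mx]; exists x => //.
  apply: le_trans ax _; rewrite ler_pdivrMr// mulrC.
  apply: le_trans (aT x (ltW xx)) _.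
  by have /andP[] := sT x (ltW x_gt0).
- apply/liminf_pinftyP => e e0; split=> [|M].
    exists 0; split; first exact: num_real.
    move=> x x_gt0; rewrite -(ler_pM2l x_gt0).
    have /andP[+ _] := sT x (ltW x_gt0); have /andP[+ _] := T_bnd x (ltW x_gt0).
    have : 0 <= e * x by rewrite mulr_ge0// ltW.
    lra.
  have [x + Tx] := T_fr (Num.max 0 (Num.max M (D / e))).
  rewrite !gt_max => /and3P[x_gt0 Mx Dx]; exists x => //.
  rewrite -(ler_pM2l x_gt0); have /andP[_] := sT x (ltW x_gt0).
  have := De _ _ e0 Dx; lra.
Qed.

(** Near +oo the bound is that of the upper limit.  On a compact interval away
    from 0 the function is bounded and x is bounded below.  Only when the
    half-line starts at 0 is an assumption near the origin required. *)
Lemma linear_bound (R : realType) (a : R -> R) (x0 L : R) :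
  0 <= x0 -> (forall x y, x0 <= x -> x <= y -> a x <= a y) ->
  (\forall x \near +oo, a x <= L * x) ->
  (x0 = 0 -> exists d c, 0 < d /\ forall x, 0 <= x <= d -> a x <= c * x) ->
  exists C, L <= C /\ forall x, x0 <= x -> a x <= C * x.
Proof.
move=> x00 a_nd [X [_ aX]] a_zero.
have [d [c [d0 [dx ac]]]] : exists d c, 0 < d /\ x0 <= d /\
    forall x, x0 <= x <= d -> a x <= c * x.
  have [x0E|x0N] := eqVneq x0 0.
    have [d [c [d0 ac]]] := a_zero x0E; exists d, c; rewrite x0E.
    by split=> //; split=> //; exact: ltW.
  have x0_gt0 : 0 < x0 by rewrite lt_def x0N.
  exists x0, (a x0 / x0); split=> //; split=> // x.
  by move=> /le_anti <-; rewrite divfK.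
pose Y := Num.max d (X + 1).
have dY : d <= Y by rewrite le_max lexx.
have XY : X < Y by rewrite lt_max ltrDl ltr01 orbT.
pose b := `|a Y| / d.
exists (Num.max L (Num.max c b)); split; first by rewrite le_max lexx.
move=> x xx; have x_ge0 : 0 <= x by lra.
have [xd|dx'] := leP x d.
  apply: le_trans (ac x _) _; first by rewrite xx.
  by rewrite ler_wpM2r// !le_max lexx !orbT.
have [xY|Yx] := leP x Y.
  apply: (@le_trans _ _ (b * x)); last first.
    by rewrite ler_wpM2r// !le_max lexx !orbT.
  apply: le_trans (a_nd x Y xx xY) _; apply: le_trans (ler_norm _) _.
  by rewrite /b mulrAC ler_pdivlMr// ler_wpM2l// ltW.
apply: le_trans (aX x (lt_trans XY Yx)) _.
by rewrite ler_wpM2r// le_max lexx.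
Qed.

(** * Existence of the quasi proximate order *)

Unset Implicit Arguments.

Theorem theorem1 (R : realType) (r0 : R) (A : R -> R) (rho lam : R)
  (hr0 : 1 <= r0)
  (A_gt0 : forall t, r0 <= t -> 0 < A t)
  (A_continuous : {within `[r0, +oo[, continuous A})
  (A_nondecreasing : forall s t, r0 <= s -> s <= t -> A s <= A t)
  (A_near_one : r0 = 1 -> power_bounded_near_one A)
  (A_limsup : limsup_pinfty (fun t => ln (A t) / ln t) = rho%:E)
  (A_liminf : liminf_pinfty (fun t => ln (A t) / ln t) = lam%:E)
  (lam_ge0 : 0 <= lam)
  (lam_lt_rho : lam < rho) :
  forall eta : R, 0 < eta -> eta < rho - lam ->
    exists sigma Astar : R -> R,
      [/\ quasi_proximate_order r0 sigma Astar,
          limsup_pinfty sigma = rho%:E,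
          liminf_pinfty sigma = (lam + eta)%:E &
          forall t, r0 <= t -> A t <= t `^ sigma t].
Proof.
move=> eta eta0 eta_lt.
pose a x := ln (A (expR x)); pose x0 := ln r0.
have x00 : 0 <= x0 by exact: ln_ge0.
have r0_gt0 : 0 < r0 by exact: lt_le_trans hr0.
have r0_exp x : x0 <= x -> r0 <= expR x.
  by move=> xx; rewrite -[r0]lnK ?posrE// ler_expR.
have a_nd x y : x0 <= x -> x <= y -> a x <= a y.
  move=> xx xy; have xr := r0_exp x xx; have yr := r0_exp y (le_trans xx xy).
  by rewrite /a ler_ln ?posrE ?A_gt0// A_nondecreasing// ler_expR.
have aE : (fun t => ln (A t) / ln t) \o expR = (fun x => a x / x).
  by apply/funext => x; rewrite /= expRK.
have a_sup := limsup_pinfty_expR A_limsup.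
have a_inf := liminf_pinfty_expR A_liminf.
rewrite aE in a_sup a_inf.
move/limsup_pinftyP in a_sup; move/liminf_pinftyP in a_inf.
have a_ev : \forall x \near +oo, a x <= (rho + 1) * x.
  have [[X [_ aX]] _] := a_sup 1 ltr01.
  exists (Num.max 0 X); split; first exact: num_real.
  by move=> x; rewrite gt_max => /andP[x_gt0 Xx]; rewrite -ler_pdivrMr//; exact: aX.
have a_zero : x0 = 0 -> exists d c, 0 < d /\ forall x, 0 <= x <= d -> a x <= c * x.
  move=> x0E; have r01 : r0 = 1 by rewrite -[r0]lnK ?posrE// -/x0 x0E expR0.
  have [c Ac] := A_near_one r01; exists (ln 2), c; split.
    by rewrite ln_gt0// ltr1n.
  move=> x /andP[x_ge0 x2]; have := Ac (expR x).
  rewrite -{1}expR0 ler_expR x_ge0/= -[leRHS]lnK ?posrE// ler_expR => /(_ x2).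
  rewrite -ler_ln ?posrE ?powR_gt0 ?expR_gt0//; last first.
    by apply: A_gt0; apply: r0_exp; rewrite x0E.
  by rewrite ln_powR expRK.
have [C [rhoC aC]] := linear_bound x00 a_nd a_ev a_zero.
have [||||s [ds [[ds_s s_nd [B ds_B] as_] [s_sup s_inf]]]] :=
  @log_regularization R a x0 C rho lam (lam + eta) x00 lam_ge0 _ _ _ a_nd aC a_sup.
- by lra.
- by lra.
- by lra.
- by move=> e e0; have [_] := a_inf e e0.
pose sigma t := s (ln t).
have sigma_sup : limsup_pinfty sigma = rho%:E := limsup_pinfty_ln s_sup.
have sigma_inf : liminf_pinfty sigma = (lam + eta)%:E := liminf_pinfty_ln s_inf.
have lnr t : r0 <= t -> [/\ 0 < t, 0 <= ln t & x0 <= ln t].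
  move=> rt; have t0 := lt_le_trans r0_gt0 rt; have lnt : x0 <= ln t by rewrite ler_ln.
  by split=> //; exact: le_trans lnt.
have powE t : 0 < t -> t `^ sigma t = expR (ln t * s (ln t)).
  by move=> t0; rewrite /powR gt_eqF// mulrC.
have dsigma (t : R) : r0 <= t -> is_derive t 1 sigma (ds (ln t) / t).
  move=> /lnr[t0 lnt _]; have [ds_lnt _ _] := ds_s _ lnt.
  exact: (is_derive1_comp ds_lnt (is_derive1_ln t0)).
exists sigma, (fun t => t `^ sigma t); split=> //; last first.
  move=> t rt; have [t0 lnt xt] := lnr t rt; rewrite powE//.
  rewrite -[A t]lnK ?posrE ?A_gt0// ler_expR.
  by have := as_ _ xt; rewrite /a lnK.
exists (lam + eta), rho; split=> //.
- by rewrite addr_ge0// ltW.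
- by lra.
- by move=> t /lnr[_ lnt _]; have [] := ds_s _ lnt.
- by move=> t /lnr[t0 _ _]; rewrite powR_gt0.
- exists (fun t => ds (ln t) / t); split.
    move=> t; rewrite /= in_itv/= andbT => rt.
    exact: is_derive_has_derivative_within (dsigma t rt).
  apply: continuous_in_subspaceT => t; rewrite inE/= in_itv/= andbT => /lnr[t0 lnt _].
  have [_ cds _] := ds_s _ lnt.
  apply: cvgM; last by apply: cvgV; [rewrite gt_eqF|exact: cvg_id].
  by apply: (@cvg_comp _ _ _ (@ln R) ds); [exact: continuous_ln|exact: cds].
- apply: le_lt_trans (ltry B); apply: limsup_pinfty_le.
  exists r0; split; first exact: num_real.
  move=> t /ltW rt; have [t0 lnt _] := lnr t rt.
  rewrite derive1E (@derive_val _ _ _ _ _ _ _ (dsigma t rt)).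
  by rewrite normrM normfV (gtr0_norm t0) divfK ?gt_eqF//; exact: ds_B.
- move=> t u rt tu; have [t0 lnt _] := lnr t rt.
  have [u0 _ _] := lnr u (le_trans rt tu).
  by rewrite !powE// ler_expR; apply: s_nd => //; rewrite ler_ln.
- exists (fun=> 0); split; first exact: cvg_cst.
  by apply: nearW => t; rewrite addr0 mul1r.
Qed.
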